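(* Let $p>3$ be a prime. Then $$\sum_{k=0}^{(p-1)/2}\frac{\binom{2k}{k}}{(k+1)16^k}T_{2k}(4,1)\equiv\frac43\left(\left(\frac3p\right)-p\left(\frac{-1}{p}\right)\right)\pmod{p^2}.$$
   Context: For $n\in\mathbb{N}=\{0,1,2,\ldots\}$ and $b,c\in\mathbb{C}$, the generalized central trinomial coefficient is $T_n(b,c)=[x^n](x^2+bx+c)^n=\sum_{j=0}^{\lfloor n/2\rfloor}\binom{n}{2j}\binom{2j}{j}b^{n-2j}c^j$. The symbol $\left(\frac{\cdot}{p}\right)$ is the Legendre symbol. Congruences between rational numbers modulo $p^2$ are understood in the ring of rational numbers whose denominators are prime to $p$ (equivalently in $\mathbb{Z}_p$). *)

(* Defs.v *)
From mathcomp Require Import all_boot all_order all_algebra.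

Set Implicit Arguments.
Unset Strict Implicit.
Unset Printing Implicit Defensive.

Import Order.TTheory GRing.Theory Num.Theory.
Local Open Scope ring_scope.

(* Stated over an arbitrary commutative ring, so that integer arguments can be
   taken directly in rat; the value commutes with ring morphisms. *)
Definition trinomial_coef (R : comNzRingType) (n : nat) (b c : R) : R :=
  (('X^2 + b *: 'X + c%:P) ^+ n)`_n.

(* Meant for p an odd prime. *)
Definition legendre (a : int) (p : nat) : int :=
  if (p %| a)%Z then 0
  else if [exists x : 'I_p, ((x : nat)%:Z ^+ 2 == a %[mod p])%Z] then 1
  else -1.

(* The localization of the integers at the prime p. *)
Definition p_integral (p : nat) : {pred rat} :=
  [pred x : rat | coprime p `|denq x|%N].

(* Both sides are required to be p-integral, so that the congruence really
   takes place in the ring of p-integral rationals. *)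
Definition p_congr (p m : nat) (x y : rat) : Prop :=
  [/\ x \in p_integral p, y \in p_integral p
    & exists2 z : rat, z \in p_integral p & x - y = m%:R * z].

(* Main.v *)
Require Import Defs.
From mathcomp Require Import all_boot all_order all_algebra.
From mathcomp Require Import qpoly finfield ring lra zify.

Import GRing.Theory Num.Theory.
Local Open Scope ring_scope.

(** Write p = 2n+1, T_k for T_k(4,1), and D_m = sum_k C(m+k,2k) C(2k,k) for
    the central Delannoy numbers.

    From Catalan numbers to Delannoy numbers.  Modulo p^2 the coefficient
    C(2k,k) may be replaced by (-16)^k C(n+k,2k) ([central_bin_cong]).  The
    polynomials sum_k (-1)^k C(n+k,2k) u^(2k) are Chebyshev polynomials: they
    equal cos(p t)/cos(t) when u = 2 sin t.  On the other side
    x^2+4x+1 = 2x + (1+x)^2 says that T_k is the value at u^k of the linear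
    form sending (u-2)^j to C(2j,j).  Expanding the Chebyshev polynomials at
    u = 2 therefore evaluates the sums of T_2k with these coefficients in terms
    of the D_m ([trinomial_cheb_sum_step]).  The division by k+1 costs one
    summation on n and gives the exact identity [catalan_cheb_sum]: n(n+1)
    times the modified sum is A = sum_(1<=i<=n) (-1)^i i (D_(2i) + D_(2i-1)).
    Since 4n(n+1) = p^2 - 1, the sum of the theorem is -4A modulo p^2.

    From A to an unweighted sum.  The three-term recurrence of the D_m turns A
    into B = sum_(m<p) e_m D_m, with signs e = 1,1,-1,-1,1,..., up to a
    boundary term ([alternating_delannoy_sum]):
    4(3A + B) = (-1)^n p (D_(p-1) + D_p).  As D_(p-1) + D_p = 4 modulo p, the
    boundary term is responsible for the summand p(-1/p).

    Evaluation of B modulo p^2.  The signs e_m are the real parts of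
    (1-i) i^m, and D_m is the coefficient of t^m in f^m, f = (1+t)(1+2t).  So
    the sum of the i^m D_m is a coefficient of f^p/(f + it), a polynomial
    divided by (1-at)(1-bt), and below degree p the power f^p is known modulo
    p^2 because (1+t)^p and (1+2t)^p are.  This gives a closed form in the
    p-th powers of a, a+1, a+2 and of their analogues for b
    ([weighted_delannoy_sum]).  All of these lie in Z[w], w a primitive 12th
    root of unity, and are products of roots of unity, powers of 1+i, halves
    and the numbers sqrt 3 + 1 and sqrt 3 - 1.  With (1+sqrt 3)^p = M + N sqrt 3,
    G = +-2^n the sign-adjusted real part of (1-i)(1+i)^(p-1), and c the sign
    for which w^p + w^-p = c sqrt 3, one finds
    G (B - c) = (1 - G)(N - G c) modulo p^2.  Both factors on the right vanish
    modulo p by the Frobenius map, so B = c modulo p^2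
    ([delannoy_sum_mod]).  Finally c = 3^n modulo p, and the Euler criterion
    identifies c with (3/p) and (-1)^n with (-1/p). *)

(** * Central Delannoy numbers *)

Definition delannoy_term (m k : nat) : nat := ('C(m + k, 2 * k) * 'C(2 * k, k))%N.

Definition delannoy (m : nat) : nat :=
  (\sum_(0 <= k < m.+1) delannoy_term m k)%N.

(** The summand times k!^2 is (m+k)(m+k-1)...(m-k+1), a polynomial in m that
    also vanishes for k > m: this is what makes termwise recurrences in m free of
    boundary cases. *)
Lemma delannoy_term_ffact m k : (delannoy_term m k * k`! ^ 2 = (m + k) ^_ (2 * k))%N.
Proof.
rewrite /delannoy_term -bin_ffact -mulnA; congr (_ * _)%N.
have kk : (k <= 2 * k)%N by lia.
rewrite -(bin_fact kk); congr (_ * _)%N.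
by rewrite -mulnn; congr (_ * _`!)%N; lia.
Qed.

Lemma delannoy_term_small m k : (m < k)%N -> delannoy_term m k = 0%N.
Proof. by move=> mk; rewrite /delannoy_term bin_small //; lia. Qed.

Lemma delannoy_term_bin m k : (k <= m)%N ->
  (delannoy_term m k = 'C(m, k) * 'C(m + k, k))%N.
Proof.
rewrite /delannoy_term => lekm; apply/eqP; have kk : (k <= 2 * k)%N by lia.
have k2 : (2 * k <= m + k)%N by lia.
have k1 : (k <= m + k)%N by lia.
have H0 : (0 < k`! * (k`! * (m - k)`!))%N by rewrite !muln_gt0 !fact_gt0.
rewrite -(eqn_pmul2r H0); apply/eqP.
have e1 := bin_fact kk; have e2 := bin_fact k2; have e3 := bin_fact k1.
have e4 := bin_fact lekm.
have E1 : (2 * k - k = k)%N by lia.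
have E2 : (m + k - 2 * k = m - k)%N by lia.
rewrite E1 in e1; rewrite E2 in e2; rewrite addnK in e3.
transitivity (m + k)`!.
  by rewrite -e2 -e1; ring.
by rewrite -e3 -e4; ring.
Qed.

Lemma delannoy_widen m N :
  (m < N)%N -> delannoy m = (\sum_(0 <= k < N) delannoy_term m k)%N.
Proof.
move=> mN; rewrite (@big_cat_nat _ _ _ m.+1) //= [X in (_ + X)%N]big1_seq ?addn0 // => k.
by rewrite mem_index_iota => /andP[_ /andP[mk _]]; apply: delannoy_term_small.
Qed.

(** The recurrence (m+2) P_(m+2) + (m+1) P_m = (2m+3) x P_(m+1) of the Legendre
    polynomials, written with x = 1 + 2y and read on the coefficient of y^(k+1); the
    Delannoy numbers are the values at y = 1. *)
Lemma delannoy_term_rec m k :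
  (m.+2%:R * (delannoy_term m.+2 k.+1)%:R + m.+1%:R * (delannoy_term m k.+1)%:R : rat) =
  (2 * m + 3)%:R * ((delannoy_term m.+1 k.+1)%:R + 2%:R * (delannoy_term m.+1 k)%:R).
Proof.
have k0 : (k.+1)`!%:R ^+ 2 != 0 :> rat.
  by rewrite expf_neq0 // pnatr_eq0 -lt0n fact_gt0.
have E n j : (delannoy_term n j)%:R * j`!%:R ^+ 2 = ((n + j) ^_ (2 * j))%:R :> rat.
  by rewrite -natrX -natrM delannoy_term_ffact.
apply: (mulIf k0).
have -> : (m.+2%:R * (delannoy_term m.+2 k.+1)%:R +
  m.+1%:R * (delannoy_term m k.+1)%:R) * k.+1`!%:R ^+ 2 =
   m.+2%:R * ((m.+2 + k.+1) ^_ (2 * k.+1))%:R + m.+1%:R * ((m +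
     k.+1) ^_ (2 * k.+1))%:R :> rat.
  by rewrite -!E; ring.
have -> : ((2 * m + 3)%:R * ((delannoy_term m.+1 k.+1)%:R +
  2%:R * (delannoy_term m.+1 k)%:R)) * k.+1`!%:R ^+ 2 =
   (2 * m + 3)%:R * (((m.+1 + k.+1) ^_ (2 * k.+1))%:R + 2%:R * k.+1%:R ^+ 2 * ((m.+1 +
     k) ^_ (2 * k))%:R) :> rat.
  by rewrite -!E factS natrM; ring.
have -> : (2 * k.+1 = (2 * k).+2)%N by lia.
have -> : (m.+2 + k.+1 = (m.+1 + k).+2)%N by lia.
have -> : (m.+1 + k.+1 = (m.+1 + k).+1)%N by lia.
have -> : (m + k.+1 = m.+1 + k)%N by lia.
have [t tE] : exists t, t = (m.+1 + k)%N by exists (m.+1 + k)%N.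
have [u uE] : exists u, u = (2 * k)%N by exists (2 * k)%N.
rewrite -tE -uE !ffactSS [(t ^_ u.+2)%N]ffactnSr !ffactnSr !natrM.
case: (ltnP m.+1 k) => [mk|km].
  by rewrite [(t ^_ u)%N]ffact_small; [ring | lia].
have -> : (t - u)%:R = m.+1%:R - k%:R :> rat by rewrite -natrB //; congr _%:R; lia.
have [kE|nk] := eqVneq k m.+1.
  by move: (t - u.+1)%:R => z; rewrite tE kE !(natrD, mulrSr); ring.
have -> : (t - u.+1)%:R = m%:R - k%:R :> rat by rewrite -natrB //; [congr _%:R|]; lia.
rewrite tE !(natrD, mulrSr); ring.
Qed.

Lemma delannoy_rec m :
  m.+2%:R * (delannoy m.+2)%:R + m.+1%:R * (delannoy m)%:R =
  3%:R * (2 * m + 3)%:R * (delannoy m.+1)%:R :> rat.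
Proof.
have t0 n : delannoy_term n 0 = 1%N by rewrite /delannoy_term muln0 !bin0.
have E n j : (n <= j)%N ->
    (delannoy n)%:R = 1 + \sum_(0 <= k < j) (delannoy_term n k.+1)%:R :> rat.
  by move=> nj; rewrite (delannoy_widen _ j.+1) // natr_sum big_nat_recl //= t0.
have E1 : (delannoy m.+1)%:R = \sum_(0 <= k < m.+2) (delannoy_term m.+1 k)%:R :> rat.
  by rewrite (delannoy_widen _ m.+2) // natr_sum.
rewrite (E m.+2 m.+2) // (E m m.+2); last by lia.
transitivity ((2 * m + 3)%:R * ((delannoy m.+1)%:R + 2%:R * (delannoy m.+1)%:R) : rat);
  last by ring.
rewrite {1}(E m.+1 m.+2) // E1.
rewrite !mulrDr !mulr_sumr !mulr1 addrACA -big_split /=.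
under eq_bigr do rewrite delannoy_term_rec mulrDr.
rewrite big_split /= addrA; congr (_ + _ + _).
by rewrite -natrD; congr _%:R; lia.
Qed.

(** The signs (-1)^(m./2), in the pattern +,+,-,-, are the real parts of
    (1-i) i^m (see [quarter_turn_sum]). *)
Definition delannoy_sum (n : nat) : int :=
  \sum_(0 <= m < (2 * n).+1) (-1) ^+ m./2 * (delannoy m)%:R.

(** By induction on n, using the recurrence at 2n and 2n+1. The right-hand side
    is the boundary term left by summing the recurrence against the powers of i. *)
Lemma alternating_delannoy_sum n :
  4%:R * (3%:R * \sum_(1 <= i < n.+1) (-1) ^+ i * i%:R *
            ((delannoy (2 * i))%:R + (delannoy (2 * i).-1)%:R)
          + (delannoy_sum n)%:~R) =
  (-1) ^+ n * (2 * n).+1%:R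
     * ((delannoy (2 * n))%:R + (delannoy (2 * n).+1)%:R) :> rat.
Proof.
elim: n => [|n IH].
  rewrite big_geq // /delannoy_sum big_nat1 /= /delannoy muln0.
  by rewrite !big_nat_recl //= !big_geq.
have eS : (delannoy_sum n.+1)%:~R = (delannoy_sum n)%:~R +
  (-1) ^+ n * (delannoy (2 * n).+1)%:R - (-1) ^+ n * (delannoy (2 * n).+2)%:R :> rat.
  rewrite /delannoy_sum.
  have -> : (2 * n.+1 = (2 * n).+2)%N by lia.
  have h1 : ((2 * n).+1./2 = n)%N by lia.
  have h2 : ((2 * n).+2./2 = n.+1)%N by lia.
  rewrite big_nat_recr // big_nat_recr // h1 h2 exprS mulN1r mulNr.
  by rewrite 2!rmorphD rmorphN 2!rmorphM (rmorphXn _ n) rmorphN1 !rmorph_nat.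
rewrite big_nat_recr // {}eS.
have -> : (2 * n.+1 = (2 * n).+2)%N by lia.
have := delannoy_rec (2 * n); have := delannoy_rec (2 * n).+1.
have tE : (2 * n)%:R = 2%:R * n%:R :> rat by rewrite natrM.
have e3 : (2 * (2 * n) + 3)%:R = 4%:R * n%:R + 3%:R :> rat by rewrite natrD !natrM; ring.
have e5 : (2 * (2 * n).+1 + 3)%:R = 4%:R * n%:R + 5%:R :> rat.
  by rewrite natrD natrM [(2 * n).+1%:R]mulrSr tE; ring.
rewrite {}e3 {}e5; move: (2 * n)%N tE IH => t tE; rewrite exprS.
rewrite /= !mulrSr tE.
set S := \sum_(1 <= i < n.+1) _; set B := _%:~R; set s := (-1) ^+ n.
move: (delannoy t)%:R (delannoy t.+1)%:R (delannoy t.+2)%:R (delannoy t.+3)%:R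
  => d0 d1 d2 d3.
(* Eliminate D_(2n+3), then the terms D_(2n+2) with coefficient 2n+2. *)
move: S B s n%:R => S B s x IH r3 r2.
have {}r3 : (2%:R * x + 3%:R) * d3
  = 3%:R * (4%:R * x + 5%:R) * d2 - (2%:R * x + 2%:R) * d1.
  by move: r3; lra.
have {}r2 : (2%:R * x + 2%:R) * d2 = 3%:R * (4%:R * x + 3%:R) * d1 - (2%:R * x + 1) * d0.
  by move: r2; lra.
transitivity (4%:R * (3%:R * S + B) + 4%:R * (- 3%:R * s * (x + 1) * (d2 + d1) + s * d1 -
  s * d2)).
  by ring.
rewrite IH.
transitivity (- s * ((2%:R * x + 3%:R) * d2 + (2%:R * x + 3%:R) * d3)); last by ring.
rewrite r3.
transitivity (- s * (3%:R * (4%:R * x + 5%:R) * d2 + d2 - (2%:R * x + 2%:R) * d1 +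
  (2%:R * x + 2%:R) * d2)); last by ring.
rewrite r2; ring.
Qed.

Lemma dvdn_sum_nat (d m n : nat) (F : nat -> nat) :
  (forall k, (m <= k < n)%N -> (d %| F k)%N) -> (d %| \sum_(m <= k < n) F k)%N.
Proof.
by move=> H; rewrite big_seq; apply: dvdn_sum => k; rewrite mem_index_iota; apply: H.
Qed.

(** In sum_k C(p,k) C(p+k,k) only k = 0 and k = p survive modulo p, and
    C(2p,p) = 2 by the Vandermonde identity. *)
Lemma delannoy_prime p : prime p -> (delannoy p = 3 %[mod p])%N.
Proof.
move=> pp; have p0 := prime_gt0 pp.
rewrite (delannoy_widen p p.+1) // big_ltn // big_nat_recr //=.
rewrite !delannoy_term_bin // bin0 binn !mul1n addn0 bin0.
have /dvdnP[a ->] : (p %| \sum_(1 <= k < p) delannoy_term p k)%N.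
  apply: dvdn_sum_nat => k /andP[k0 kp]; rewrite delannoy_term_bin ?(ltnW kp) //.
  by apply: dvdn_mulr; apply: prime_dvd_bin; rewrite ?k0.
have -> : ('C(p + p, p) = 2 + \sum_(1 <= k < p) 'C(p, k) * 'C(p, p - k))%N.
  rewrite -binomial.Vandermonde -(big_mkord xpredT (fun k => 'C(p, k) * 'C(p, p - k))%N).
  rewrite big_ltn // big_nat_recr //= subn0 subnn !bin0 !binn; lia.
have /dvdnP[b ->] : (p %| \sum_(1 <= k < p) 'C(p, k) * 'C(p, p - k))%N.
  apply: dvdn_sum_nat => k /andP[k0 kp].
  by apply: dvdn_mulr; apply: prime_dvd_bin; rewrite ?k0.
have -> : (1 + (a * p + (2 + b * p)) = (a + b) * p + 3)%N by lia.
by rewrite modnMDl.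
Qed.

(** In sum_k C(p-1,k) C(p-1+k,k) only k = 0 survives modulo p, because
    k C(p-1+k,k) = p C(p-1+k,k-1). *)
Lemma delannoy_prime_pred p : prime p -> (delannoy p.-1 = 1 %[mod p])%N.
Proof.
move=> pp; have p0 := prime_gt0 pp.
rewrite (delannoy_widen p.-1 p) ?prednK // big_ltn //.
rewrite delannoy_term_bin // !bin0 mul1n.
have /dvdnP[a ->] : (p %| \sum_(1 <= k < p) delannoy_term p.-1 k)%N.
  apply: dvdn_sum_nat => -[//|k] /andP[_ kp]; rewrite delannoy_term_bin; last by lia.
  apply: dvdn_mull.
  have -> : (p.-1 + k.+1 = p + k)%N by lia.
  have := mul_bin_left (p + k) k; rewrite addnK => e.
  rewrite -(@Gauss_dvdr _ k.+1); last by rewrite prime_coprime // gtnNdvd.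
  by rewrite e dvdn_mulr.
by rewrite addnC modnMDl.
Qed.

(** * Geometric sums of Delannoy numbers modulo the square of a prime *)

Lemma coef_div_geometric (R : comNzRingType) (a : R) (K : {poly R}) n :
  K`_n = \sum_(0 <= i < n.+1) (K * (1 - a *: 'X))`_i * a ^+ (n - i).
Proof.
have E i : (K * (1 - a *: 'X))`_i = K`_i - (if i == 0%N then 0 else a * K`_i.-1).
  by rewrite mulrBr mulr1 -scalerAr coefB coefZ coefMX; case: ifP => // _; rewrite mulr0.
elim: n => [|n IH]; first by rewrite big_nat1 E /= subr0 mulr1.
rewrite big_nat_recr //= subnn mulr1 E /= {1}IH mulr_sumr.
rewrite (eq_big_nat _ _ (F1 := fun i => (K * (1 - a *: 'X))`_i * a ^+ (n.+1 - i))
  (F2 := fun i => a * ((K * (1 - a *: 'X))`_i * a ^+ (n - i)))).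
  by rewrite addrC subrK.
by move=> i /andP[_ lin]; rewrite subSn // exprS mulrCA.
Qed.

(** Coefficient extraction from H / ((1-aX)(1-bX)), H being the product on the
    right, by partial fractions; since F itself is the quotient, this is an identity
    between polynomials, and it holds over any commutative ring. *)
Lemma coef_div_quadratic (R : comNzRingType) (a b : R) (F : {poly R}) n :
  (a - b) * F`_n =
  \sum_(0 <= i < n.+1) (F * ((1 - a *: 'X) * (1 - b *: 'X)))`_i
     * (a ^+ (n.+1 - i) - b ^+ (n.+1 - i)).
Proof.
have E c : (F * (1 - c *: 'X))`_n = F`_n - (if n == 0%N then 0 else c * F`_n.-1).
  by rewrite mulrBr mulr1 -scalerAr coefB coefZ coefMX; case: ifP => // _; rewrite mulr0.
have -> : (a - b) * F`_n =
   a * (F * (1 - b *: 'X))`_n - b * (F * (1 - a *: 'X))`_n.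
  by rewrite !E; case: ifP => _; ring.
rewrite (coef_div_geometric _ a) (coef_div_geometric _ b (_ * (1 - a *: 'X))).
rewrite !mulr_sumr -sumrB; apply: eq_big_nat => i /andP[_ lin].
have -> : F * (1 - b *: 'X) * (1 - a *: 'X) = F * ((1 - a *: 'X) * (1 - b *: 'X)).
  by rewrite -mulrA [(1 - b *: 'X) * _]mulrC.
by rewrite -mulrA subSn // !exprS; ring.
Qed.

Definition delannoy_poly (R : comNzRingType) : {poly R} := (1 + 'X) * (1 + 2%:R *: 'X).

Lemma coef_exp_1XZ (R : comNzRingType) (c : R) m i :
  ((1 + c *: 'X) ^+ m)`_i = 'C(m, i)%:R * c ^+ i.
Proof.
rewrite exprDn coef_sum; case: (leqP i m) => lim; last first.
  rewrite bin_small // mul0r big1 // => j _.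
  rewrite expr1n mul1r exprZn coefMn coefZ coefXn.
  by rewrite gtn_eqF ?mulr0 ?mul0rn //; apply: leq_ltn_trans lim; rewrite -ltnS.
rewrite (bigD1 (inord i)) //= big1 ?addr0; last first.
  move=> j; rewrite -val_eqE /= inordK // => ji.
  by rewrite expr1n mul1r exprZn coefMn coefZ coefXn eq_sym (negPf ji) mulr0 mul0rn.
by rewrite inordK // expr1n mul1r exprZn coefMn coefZ coefXn eqxx mulr1 mulr_natl.
Qed.

Lemma coef_exp_1X (R : comNzRingType) m i :
  (((1 : {poly R}) + 'X) ^+ m)`_i = 'C(m, i)%:R.
Proof. by rewrite -['X]scale1r coef_exp_1XZ expr1n mulr1. Qed.

Lemma coef_delannoy_poly_diag (R : comNzRingType) m :
  (delannoy_poly R ^+ m)`_m = (delannoy m)%:R.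
Proof.
(* Expanding (1+X)X + (1+X)^2 produces the terms C(m,k) C(m+k,k). *)
have -> : delannoy_poly R = (1 + 'X) * 'X + (1 + 'X) ^+ 2.
  by rewrite /delannoy_poly scaler_nat; ring.
rewrite exprDn coef_sum /delannoy natr_sum big_mkord.
apply: eq_bigr => -[k /= ltkm] _.
have lekm : (k <= m)%N by rewrite -ltnS.
rewrite -exprM exprMn mulrAC -exprD coefMn coefMXn ltnNge leq_subr /= coef_exp_1X.
have -> : (m - k + 2 * k = m + k)%N by lia.
have -> : (m - (m - k) = k)%N by lia.
by rewrite delannoy_term_bin // natrM mulr_natl.
Qed.

(** The inner terms of the convolution of (1+X)^p and (1+2X)^p carry two binomial
    coefficients divisible by p. *)
Lemma coef_delannoy_poly_exp_prime (R : comNzRingType) p i : prime p ->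
  (p ^ 2)%:R = 0 :> R -> (0 < i < p)%N ->
  (delannoy_poly R ^+ p)`_i = 'C(p, i)%:R * (1 + 2%:R ^+ i).
Proof.
case: i => [|i]; first by [].
move=> pp p20 /andP[i0 ip].
rewrite exprMn coefM big_ord_recr /= big_ord_recl /= subnn subn0.
rewrite !coef_exp_1X !coef_exp_1XZ !bin0 expr0 !mul1r mulr1.
rewrite big1 ?addr0; last first.
  case=> [j /= ltj] _; rewrite !coef_exp_1X !coef_exp_1XZ.
  have d1 : (p %| 'C(p, bump 0 j))%N.
    by apply: prime_dvd_bin => //; rewrite /bump leq0n /=;
      apply: leq_ltn_trans ltj (ltnW ip).
  have d2 : (p %| 'C(p, i.+1 - bump 0 j))%N.
    apply: prime_dvd_bin => //; rewrite /bump leq0n add1n subSS subn_gt0 ltj /=.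
    by apply: leq_ltn_trans (leq_subr _ _) (ltnW ip).
  rewrite mulrA -natrM; have /dvdnP[c ->] := dvdn_mul d1 d2.
  by rewrite mulnn natrM p20 mulr0 mul0r.
by rewrite mulrDr mulr1 addrC.
Qed.

Lemma sum_coef_delannoy_poly_exp_prime (R : comNzRingType) p (a : R) : prime p ->
  (p ^ 2)%:R = 0 :> R ->
  \sum_(0 <= i < p) (delannoy_poly R ^+ p)`_i * a ^+ (p - i) =
  (a + 1) ^+ p + (a + 2%:R) ^+ p - a ^+ p - 1 - 2%:R ^+ p.
Proof.
move=> pp p20; have p0 := prime_gt0 pp.
have E c : (a + c) ^+ p = a ^+ p + c ^+ p +
  \sum_(1 <= i < p) 'C(p, i)%:R * c ^+ i * a ^+ (p - i).
  rewrite exprDn -(big_mkord predT (fun i => a ^+ (p - i) * c ^+ i *+ 'C(p, i))).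
  rewrite big_nat_recr //= big_ltn // subn0 subnn bin0 binn mulr1 mul1r !mulr1n.
  rewrite addrAC; congr (_ + _); apply: eq_bigr => i _.
  by rewrite -mulr_natl; ring.
rewrite !E expr1n big_ltn // subn0 exprMn coefM big_ord_recl big_ord0 /= addr0.
rewrite coef_exp_1X coef_exp_1XZ !bin0 !mul1r.
rewrite [X in _ + X = _](eq_big_nat _ _ (F2 := fun i =>
  'C(p, i)%:R * 1 ^+ i * a ^+ (p - i) + 'C(p, i)%:R * 2%:R ^+ i * a ^+ (p - i)));
    last first.
  by move=> i ip; rewrite -exprMn coef_delannoy_poly_exp_prime // expr1n; ring.
rewrite big_split /=; ring.
Qed.

(** With F = sum_m (cX)^(p-1-m) f^m, where f = (1+X)(1+2X), the sum on the left is
    the coefficient of X^(p-1) in F. The geometric sum gives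
    F (f - cX) = f^p - (cX)^p, the subtracted power does not reach degree p-1, and
    the hypotheses on a and b say f - cX = (1-aX)(1-bX). *)
Lemma weighted_delannoy_sum (R : comNzRingType) p (a b c : R) : prime p ->
  (p ^ 2)%:R = 0 :> R -> a + b = c - 3%:R -> a * b = 2%:R ->
  (a - b) * \sum_(0 <= m < p) c ^+ (p.-1 - m) * (delannoy m)%:R =
  ((a + 1) ^+ p + (a + 2%:R) ^+ p - a ^+ p)
    - ((b + 1) ^+ p + (b + 2%:R) ^+ p - b ^+ p).
Proof.
move=> pp p20 sab pab; have p0 := prime_gt0 pp.
pose F : {poly R} := \sum_(0 <= m < p) (c *: 'X) ^+ (p.-1 - m) * delannoy_poly R ^+ m.
have EF : F`_p.-1 = \sum_(0 <= m < p) c ^+ (p.-1 - m) * (delannoy m)%:R.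
  rewrite coef_sum; apply: eq_big_nat => m /andP[_ mp].
  rewrite exprZn -scalerAl coefZ mulrC -coef_delannoy_poly_diag.
  have lt1 : (p.-1 - m <= p.-1)%N by apply: leq_subr.
  rewrite ['X^_ * _]mulrC coefMXn ltnNge lt1 /= mulrC; congr (_ * _`_ _).
  by rewrite subKn // -ltnS prednK.
have FM : F * ((1 - a *: 'X) * (1 - b *: 'X)) = delannoy_poly R ^+ p - (c *: 'X) ^+ p.
  rewrite subrXX -[RHS]mulrC; congr (_ * _); last first.
    have cE : c%:P = a%:P + b%:P + 3%:R :> {poly R}.
      by rewrite -polyCD sab polyCB polyC_natr subrK.
    have abE : a%:P * b%:P = 2%:R :> {poly R} by rewrite -polyCM pab polyC_natr.
    rewrite /delannoy_poly -!mul_polyC polyC_natr cE.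
    transitivity (1 - (a%:P + b%:P) * 'X + 2%:R * 'X ^+ 2 : {poly R}).
      by rewrite -abE; ring.
    by ring.
  rewrite /F big_mkord (reindex_inj rev_ord_inj) /=; apply: eq_bigr => -[m /= mp] _.
  by rewrite mulrC; congr (_ ^+ _ * _ ^+ _); lia.
rewrite -EF coef_div_quadratic FM prednK //.
rewrite (eq_big_nat _ _ (F2 := fun i
  => (delannoy_poly R ^+ p)`_i * a ^+ (p - i) - (delannoy_poly R ^+ p)`_i * b ^+ (p -
    i))).
  by rewrite sumrB !sum_coef_delannoy_poly_exp_prime //; ring.
move=> i /andP[_ ip].
by rewrite coefB exprZn coefZ coefXn (ltn_eqF ip) mulr0 subr0 mulrBr.
Qed.

(** * Twelfth roots of unity *)

(** Z[w] modulo m, for w a primitive 12th root of unity with minimal polynomial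
    X^4 - X^2 + 1: congruences between algebraic integers become equalities there,
    and congruences between integers can be read back. *)
Lemma twelfth_root_mod m : (1 < m)%N ->
  exists (R : comNzRingType) (w : R),
    [/\ w ^+ 4 = w ^+ 2 - 1, m%:R = 0 :> R
      & forall z : int, z%:~R = 0 :> R -> (m %| z)%Z].
Proof.
move=> m1; pose h : {poly 'Z_m} := 'X^4 - 'X^2 + 1.
have hE : h = 'X^4 + (1 - 'X^2) by rewrite /h; ring.
have sz : (size (1 - 'X^2 : {poly 'Z_m})%R <= 3)%N.
  apply: leq_trans (size_polyD _ _) _.
  by rewrite size_polyN size_polyXn size_poly1.
have szh : size h = 5%N.
  by rewrite hE size_polyDl size_polyXn //; apply: leq_ltn_trans sz _.
have hmon : h \is monic.
  by rewrite monicE hE lead_coefDl ?lead_coefXn // size_polyXn; apply: leq_ltn_trans sz _.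
have mkh : mk_monic h = h by rewrite /mk_monic szh hmon.
exists {poly %/ h}, 'qX; split.
- apply/eqP; rewrite -subr_eq0 opprB addrA -/(qpolyX h).
  rewrite /qpolyX -!rmorphXn -!(rmorph1 (in_qpoly h)) -rmorphD -rmorphB.
  apply/eqP/val_inj => /=; rewrite mkh.
  have -> : 'X^4 + 1 - 'X^2 = h by rewrite /h addrAC.
  exact: Pdiv.RingMonic.rmodpp.
- by rewrite -(rmorph_nat (qpolyC h)) pchar_Zp // rmorph0.
move=> z z0.
have {}z0 : z%:~R = 0 :> 'Z_m.
  have : qpolyC h z%:~R = 0 by rewrite rmorph_int z0.
  move/(congr1 (fun q : {poly %/ h} => (q : {poly 'Z_m})`_0)).
  by rewrite /= coefC coef0.
suff : (m %| `|z|)%N by rewrite dvdzE.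
have : (`|z|%N%:R : 'Z_m) = 0.
  case: z z0 => // k; rewrite NegzE rmorphN /= => /eqP; rewrite oppr_eq0 => /eqP.
  by [].
move/(congr1 val) => /=; rewrite val_Zp_nat //.
by move=> /eqP; rewrite /dvdn => /eqP ->.
Qed.

Lemma exp_1_sqrt3 m : exists M N : int, forall (R : comNzRingType) (r : R),
  r ^+ 2 = 3%:R -> (1 + r) ^+ m = M%:~R + N%:~R * r.
Proof.
elim: m => [|m [M [N IH]]]; first by exists 1, 0 => R r _; rewrite expr0 mul0r addr0.
exists (M + 3 * N), (M + N) => R r r2.
by rewrite exprS IH // !rmorphD rmorphM /=; ring: r2.
Qed.

(** Twice the real part of (1-i) i^m. *)
Lemma quarter_turn_sum (R : comNzRingType) (i : R) m : i ^+ 2 = -1 ->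
  (1 - i) * i ^+ m + (1 + i) * (- i) ^+ m = 2%:R * (-1) ^+ m./2.
Proof.
move=> i2; have n2 : (- i) ^+ 2 = -1 by rewrite sqrrN.
have ED (c : R) : c ^+ m = c ^+ odd m * (c ^+ 2) ^+ m./2.
  by rewrite -exprM -exprD mul2n odd_double_half.
rewrite !ED i2 n2.
by case: (odd m); rewrite ?expr0 ?expr1; ring: i2.
Qed.

(** For p = 6q+1 or p = 6q-1 this is (-1)^q = 2 cos(p pi/6) / sqrt 3, which will
    turn out to be (3/p). *)
Definition twelfth_sign (p : nat) : int := (-1) ^+ (p.+1 %/ 6).

(** The real part of (1-i) (1+i)^(2n) = (1-i) (2i)^n. *)
Definition gauss_real_part (n : nat) : int := 2 ^+ n * (-1) ^+ n./2.

Section TwelfthRoot.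
Variables (R : comNzRingType) (w : R).
Hypothesis w4 : w ^+ 4 = w ^+ 2 - 1.

(* In C these are w^-1, the imaginary unit and the square root of 3. *)
Let v := w - w ^+ 3.
Let i := w ^+ 3.
Let r := w + v.

Lemma root12_vw : v * w = 1. Proof. rewrite /v; ring: w4. Qed.

Lemma root12_i2 : i ^+ 2 = -1. Proof. rewrite /i; ring: w4. Qed.

Lemma root12_r2 : r ^+ 2 = 3%:R. Proof. rewrite /r /v; ring: w4. Qed.

Lemma root12_v4 : v ^+ 4 = v ^+ 2 - 1. Proof. rewrite /v; ring: w4. Qed.

Lemma root12_v3 : v ^+ 3 = - i. Proof. rewrite /i /v; ring: w4. Qed.

Lemma root12_exp p : coprime p 6 ->
  w ^+ p + v ^+ p = (twelfth_sign p)%:~R * r /\ w ^+ p - v ^+ p = i ^+ p.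
Proof.
move=> cp.
have w6 : w ^+ 6 = -1 by ring: w4.
have v6 : v ^+ 6 = -1 by ring: root12_v4.
have i6 : i ^+ 6 = -1 by rewrite /i -exprM mulnC exprM w6; ring.
have ED (c : R) q k : c ^+ (6 * q + k) = (c ^+ 6) ^+ q * c ^+ k.
  by rewrite exprD exprM.
have [[q E]|[q E]] : (exists q, p = 6 * q + 1) %N \/ (exists q, p = 6 * q + 5)%N.
- move: cp; rewrite (divn_eq p 6); move: (p %/ 6)%N (ltn_pmod p (isT : (0 < 6)%N)) => q.
  rewrite mulnC -coprime_modl; case: (p %% 6)%N => [|[|[|[|[|[|]]]]]] // _;
  rewrite mulnC modnMDl //= => _; [left|right]; by exists q; rewrite mulnC.
- have -> : twelfth_sign p = (-1) ^+ q.
    by rewrite /twelfth_sign E; congr (_ ^+ _); lia.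
  rewrite E !ED w6 v6 i6 !expr1 rmorphXn rmorphN1; split; rewrite /r /i /v; ring.
- have -> : twelfth_sign p = (-1) ^+ q.+1.
    by rewrite /twelfth_sign E; congr (_ ^+ _); lia.
  have w5 : w ^+ 5 = - v by rewrite /v; ring: w4.
  have v5 : v ^+ 5 = - w by rewrite /v; ring: w4.
  have i5 : i ^+ 5 = i by rewrite /i; ring: w4.
  rewrite E !ED w6 v6 i6 w5 v5 i5 rmorphXn rmorphN1 exprS; split; rewrite /r /i /v; ring.
Qed.

(** All three are consequences of the Frobenius map x |-> x^p in characteristic p,
    applied to 1 + r and 1 - r, to r = w + w^-1, and to 1 + i and 1 - i.  The integer
    factors come from clearing r, 1 + i and the like by multiplication. *)
Lemma root12_mod_p p n (M N : int) : prime p -> p = (2 * n).+1 -> coprime p 6 ->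
  p%:R = 0 :> R ->
  (forall (S : comNzRingType) (s : S),
    s ^+ 2 = 3%:R -> (1 + s) ^+ p = M%:~R + N%:~R * s) ->
  [/\ (6%:R * (N - twelfth_sign p))%:~R = 0 :> R,
      (3%:R * (twelfth_sign p - 3%:R ^+ n))%:~R = 0 :> R
    & (4%:R * (gauss_real_part n - (-1) ^+ n))%:~R = 0 :> R].
Proof.
move=> pp pE cp p0 MN.
have FD : {morph (fun x : R => x ^+ p) : x y / x + y}.
  have pc : p \in [pchar R] by rewrite inE pp p0 eqxx.
  by move=> x y; rewrite -!(pFrobenius_autE pc) rmorphD.
have odd_p (c x : R) : c ^+ 2 = x -> c ^+ p = x ^+ n * c.
  by move=> <-; rewrite pE exprSr exprM.
have FN (x : R) : (- x) ^+ p = - x ^+ p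
  by rewrite pE exprNn exprSr exprM sqrrN !expr1n mul1r mulN1r.
have i2 := root12_i2; have r2 := root12_r2.
have [sumE _] := root12_exp _ cp.
have rE : r = w + v by [].
clearbody r i v.
have rp : r ^+ p = (twelfth_sign p)%:~R * r by rewrite -sumE -FD -rE.
have rp3 := odd_p _ _ r2.
have Np : 2%:R * N%:~R * r = 2%:R * r ^+ p.
  have e1 := MN _ _ r2.
  have e2 : (1 - r) ^+ p = M%:~R + N%:~R * (- r) by apply: MN; rewrite sqrrN.
  have e3 : (1 + r) ^+ p - (1 - r) ^+ p = 2%:R * r ^+ p.
    by rewrite !FD FN expr1n; ring.
  by rewrite -e3 e1 e2; ring.
have ip := odd_p _ _ i2.
have kp : (1 + i) ^+ p = 1 + i ^+ p by rewrite FD expr1n.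
have k'p : (1 - i) ^+ p = 1 - i ^+ p by rewrite FD FN expr1n.
split.
- rewrite rmorphM rmorphB /=.
  have -> : 6%:R * (N%:~R - (twelfth_sign p)%:~R)
    = r * (2%:R * N%:~R * r - 2%:R * ((twelfth_sign p)%:~R * r)).
    by ring: r2.
  by rewrite Np rp subrr mulr0.
- rewrite rmorphM rmorphB (rmorphXn _ n) !rmorph_nat /=.
  have -> : 3%:R * ((twelfth_sign p)%:~R - 3%:R ^+ n)
    = r * ((twelfth_sign p)%:~R * r - 3%:R ^+ n * r) :> R.
    by ring: r2.
  by rewrite -rp rp3 subrr mulr0.
have k2 : (1 + i) ^+ 2 = 2%:R * i by ring: i2.
have k'2 : (1 - i) ^+ 2 = 2%:R * - i by ring: i2.
have := odd_p _ _ k2; have := odd_p _ _ k'2.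
rewrite kp k'p ip !exprMn => h' h.
have q := quarter_turn_sum R i n i2.
rewrite rmorphM rmorphB rmorphM !rmorphXn rmorphN1 !rmorph_nat /=.
have -> : 4%:R * (2%:R ^+ n * (-1) ^+ n./2 - (-1) ^+ n) =
   2%:R * (2%:R ^+ n * (2%:R * (-1) ^+ n./2) - 2%:R * (-1) ^+ n) :> R by ring.
rewrite -q.
have -> : 2%:R * (2%:R ^+ n * ((1 - i) * i ^+ n + (1 + i) * (- i) ^+ n) -
   2%:R * (-1) ^+ n) = (1 - i) ^+ 2 * (2%:R ^+ n * i ^+ n * (1 + i)) +
   (1 + i) ^+ 2 * (2%:R ^+ n * (- i) ^+ n * (1 - i)) - 4%:R * (-1) ^+ n by ring: i2.
rewrite -h -h'; ring: i2.
Qed.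

(** The closed form of [weighted_delannoy_sum] for the two reciprocal roots of
    1 + (3+i)X + 2X^2, multiplied by powers of 2, by r and by (1-i)^2 to remove
    denominators. *)
Lemma root12_mod_p2 p n (M N : int) : prime p -> p = (2 * n).+1 -> coprime p 6 ->
  (p ^ 2)%:R = 0 :> R ->
  (forall (S : comNzRingType) (s : S),
    s ^+ 2 = 3%:R -> (1 + s) ^+ p = M%:~R + N%:~R * s) ->
  6%:R * 2%:R ^+ p * (1 - i) * (\sum_(0 <= m < p) (- i) ^+ (p.-1 - m) * (delannoy m)%:R) =
  3%:R * (4%:R * (1 - i) * (2%:R * i) ^+ n * N%:~R
   + 2%:R ^+ p * (2%:R * (1 - i) * (2%:R * i) ^+ n * (twelfth_sign p)%:~R
      + 2%:R * i * (M%:~R * (twelfth_sign p)%:~R + N%:~R * i ^+ p))).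
Proof.
move=> pp pE cp p0 MN.
have i2 := root12_i2; have r2 := root12_r2; have vw := root12_vw.
have [sumE difE] := root12_exp _ cp.
have vwi : w - v = i by rewrite /v /i; ring.
have rE : r = w + v by [].
have vE : v = w - w ^+ 3 by [].
have iE : i = w ^+ 3 by [].
clearbody r i v.
have FN (x : R) : (- x) ^+ p = - x ^+ p
  by rewrite pE exprNn exprSr exprM sqrrN !expr1n mul1r mulN1r.
(* a and b are the roots of x^2 + (3+i)x + 2; their difference is (1+i) r. *)
pose a := - (r - 1) * v; pose b := - (r + 1) * w.
have sab : a + b = - i - 3%:R.
  by rewrite /a /b -r2 -vwi rE; ring.
have pab : a * b = 2%:R.
  have -> : a * b = (r ^+ 2 - 1) * (v * w) by rewrite /a /b; ring.
  by rewrite r2 vw; ring.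
(* With c = -i the quadratic f - cX is f + iX. *)
have := weighted_delannoy_sum _ _ _ _ _ pp p0 sab pab.
set Z := (\sum_(0 <= m < p) _) => H.
(* Factorizations whose p-th powers are known. *)
have abE : a - b = (1 + i) * r.
  by rewrite /a /b rE iE vE; ring: w4.
have a1 : 2%:R * (a + 1) = (1 + i) * (r - 1) by rewrite /a rE iE vE; ring: w4.
have b1 : 2%:R * (b + 1) = - ((1 + i) * (1 + r)) by rewrite /b rE iE vE; ring: w4.
have a2 : a + 2%:R = (1 + i) * v by rewrite /a rE iE vE; ring: w4.
have b2 : b + 2%:R = - ((1 + i) * w) by rewrite /b rE iE vE; ring: w4.
have rp : (1 + r) ^+ p = M%:~R + N%:~R * r by exact: MN.
have rm : (r - 1) ^+ p = - M%:~R + N%:~R * r.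
  by rewrite -opprB FN (MN _ (- r)) ?sqrrN //; ring.
have k2p : (1 + i) ^+ p = (2%:R * i) ^+ n * (1 + i).
  rewrite pE exprSr exprM; congr (_ ^+ _ * _); ring: i2.
have a1p : 2%:R ^+ p * (a + 1) ^+ p = (1 + i) ^+ p * (- M%:~R + N%:~R * r).
  by rewrite -exprMn a1 exprMn rm.
have b1p : 2%:R ^+ p * (b + 1) ^+ p = - ((1 + i) ^+ p * (M%:~R + N%:~R * r)).
  by rewrite -exprMn b1 FN exprMn rp.
have ap : a ^+ p = - ((- M%:~R + N%:~R * r) * v ^+ p).
  by rewrite /a mulNr FN exprMn rm.
have bp : b ^+ p = - ((M%:~R + N%:~R * r) * w ^+ p).
  by rewrite /b mulNr FN exprMn addrC rp.
have wE : w ^+ p = (twelfth_sign p)%:~R * r - v ^+ p by rewrite -sumE; ring.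
have dE : i ^+ p = (twelfth_sign p)%:~R * r - 2%:R * v ^+ p by rewrite -difE wE; ring.
clearbody a b; rewrite a2 b2 FN ap bp abE !exprMn in H.
have H2 : 2%:R ^+ p * ((1 + i) * r * Z) =
   r * (2%:R * (1 + i) ^+ p * N%:~R + 2%:R ^+ p * ((1 + i) ^+ p * (twelfth_sign p)%:~R
    - M%:~R * (twelfth_sign p)%:~R - N%:~R * i ^+ p)).
  rewrite H !mulrBr !mulrDr a1p b1p wE dE.
  ring.
have -> : 6%:R * 2%:R ^+ p * (1 - i) * Z
  = r * (1 - i) ^+ 2 * (2%:R ^+ p * ((1 + i) * r * Z)).
  by ring: i2 r2.
rewrite H2 k2p.
ring: i2 r2.
Qed.

End TwelfthRoot.

Lemma Gauss_dvdz_natr (c m : nat) (z : int) :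
  coprime m c -> (m %| (c%:R * z)%R)%Z -> (m %| z)%Z.
Proof. by move=> cc; rewrite natz Gauss_dvdzr // /coprimez. Qed.

(** The summand of index m is reversed, (-i)^(2n-m) = (-1)^n i^m, so that the two
    conjugate sums add up to twice a real part. *)
Lemma sum_root12_delannoy (R : comNzRingType) (i : R) n : i ^+ 2 = -1 ->
  (1 - i) * (\sum_(0 <= m < (2 * n).+1) (- i) ^+ (2 * n - m) * (delannoy m)%:R) +
  (1 + i) * (\sum_(0 <= m < (2 * n).+1) i ^+ (2 * n - m) * (delannoy m)%:R) =
  2%:R * (-1) ^+ n * (delannoy_sum n)%:~R.
Proof.
move=> i2; have n2 : (- i) ^+ 2 = -1 by rewrite sqrrN.
rewrite rmorph_sum /= !mulr_sumr -big_split /=; apply: eq_big_nat => m /andP[_ lem].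
rewrite ltnS in lem.
rewrite rmorphM (rmorphXn _ m./2) rmorphN1 rmorph_nat.
have E (c : R) : c ^+ 2 = -1 -> (- c) ^+ (2 * n - m) = (-1) ^+ n * c ^+ m.
  move=> c2; have c1 : (- c) ^+ m * c ^+ m = 1.
    by rewrite -exprMn mulNr -expr2 c2 opprK expr1n.
  rewrite -[LHS]mulr1 -{1}c1 mulrA -exprD subnK //.
  by rewrite exprM sqrrN c2.
have Ei := E i i2; have En := E (- i) n2; rewrite opprK in En.
have q := quarter_turn_sum R i m i2.
by rewrite Ei En mulrACA -q; ring.
Qed.

(** Adding [root12_mod_p2] for w and for its inverse expresses B, modulo p^2,
    through g = gauss_real_part n, N and x = twelfth_sign p.  With s = (-1)^n
    and g^2 = 4^n this reads g s (B - x) = (1 - g s)(N - g s x), where g s = 1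
    and N = x modulo p. *)
Lemma delannoy_sum_mod p n : prime p -> (3 < p)%N -> p = (2 * n).+1 ->
  ((p ^ 2)%N %| delannoy_sum n - twelfth_sign p)%Z /\ (p %| twelfth_sign p - 3 ^+ n)%Z.
Proof.
move=> pp p3 pE.
have co c : (0 < c < p)%N -> coprime p c
  by move=> cp; rewrite prime_coprime // gtnNdvd //; case/andP: cp.
have cop2 : coprime p 2 by apply: co; lia.
have cop3 : coprime p 3 by apply: co; lia.
have cop4 : coprime p 4 by rewrite (coprimeXr 2 cop2).
have cop6 : coprime p 6 by rewrite (@coprimeMr p 2 3) cop2.
have cop24 : coprime p 24 by rewrite (@coprimeMr p 4 6) cop4.
have [M [N MN]] := exp_1_sqrt3 p.
have [S [u [u4 pS injS]]] := twelfth_root_mod p (prime_gt1 pp).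
have [/injS hN /injS h3 /injS hg] := root12_mod_p S u u4 p n M N pp pE cop6 pS (fun S s
  => MN S s).
have {}hN : (p %| N - twelfth_sign p)%Z by apply: (Gauss_dvdz_natr 6 p).
have {}h3 : (p %| twelfth_sign p - 3 ^+ n)%Z by apply: (Gauss_dvdz_natr 3 p).
have {}hg : (p %| gauss_real_part n - (-1) ^+ n)%Z by apply: (Gauss_dvdz_natr 4 p).
split=> //.
have p21 : (1 < p ^ 2)%N by rewrite -(exp1n 2) ltn_exp2r ?prime_gt1.
have {S u u4 pS injS} [R [w [w4 pR injR]]] := twelfth_root_mod (p ^ 2) p21.
have MN' := fun S s => MN S s.
have := root12_mod_p2 R w w4 p n M N pp pE cop6 pR MN'.
(* The inverse of w is another primitive 12th root of unity, with cube -i. *)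
have v4 := root12_v4 R w w4; have := root12_mod_p2 R _ v4 p n M N pp pE cop6 pR MN'.
have v3 : (w - w ^+ 3) ^+ 3 = - w ^+ 3 by exact: root12_v3.
rewrite v3; have i2 := root12_i2 R w w4; move: (w ^+ 3) i2 => i i2.
rewrite !opprK pE /= -pE => H1 H2.
have q := quarter_turn_sum R i n i2.
have sE := sum_root12_delannoy R i n i2; rewrite -pE in sE.
have n2 : (- i) ^+ 2 = -1 by rewrite sqrrN.
have ip : i * i ^+ p = - (-1) ^+ n by rewrite -exprS pE -addn2 exprD exprM i2; ring.
have nip : (- i) ^+ p = - i ^+ p by rewrite pE !exprSr !exprM sqrrN mulrN.
set g := gauss_real_part n in hg *; set s : int := (-1) ^+ n in hg *.
set B := delannoy_sum n in sE *; set x := twelfth_sign p in hN h3 H1 H2 *.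
have g2 : g ^+ 2 = 4%:R ^+ n.
  by rewrite /g /gauss_real_part exprMn -!exprM ![(_ * 2)%N]mulnC !exprM sqrrN !expr1n
    mulr1.
have s2 : s ^+ 2 = 1 by rewrite /s -exprM mulnC exprM sqrrN !expr1n.
have gR : g%:~R = 2%:R ^+ n * (-1) ^+ n./2 :> R.
  by rewrite rmorphM (rmorphXn _ n) (rmorphXn _ n./2) rmorphN1 rmorph_nat.
have sR : (-1) ^+ n = s%:~R :> R by rewrite (rmorphXn _ n) rmorphN1.
have p4 : 2%:R ^+ p = 2%:R * 4%:R ^+ n :> R.
  by rewrite pE exprS exprM -natrX.
have {q} q : (1 - i) * (2%:R * i) ^+ n + (1 + i) * (2%:R * (- i)) ^+ n = 2%:R * g%:~R.
  by rewrite !exprMn gR mulrCA [X in _ + X]mulrCA -mulrDr q; ring.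
rewrite nip in H1; rewrite p4 in H1 H2; rewrite sR in ip sE.
set A1 := \sum_(0 <= m < p) _ in H1 sE; set A2 := \sum_(0 <= m < p) _ in H2 sE.
clearbody g s B x A1 A2.
(* The sum of the two conjugate instances H1 and H2, from which M drops out. *)
have Z0 : ((p ^ 2)%N %| 24%:R * (4%:R ^+ n * s * B - g * N - 4%:R ^+ n * x * g +
  4%:R ^+ n * s * N))%Z.
  apply: injR.
  rewrite rmorphM rmorph_nat !rmorphD !rmorphN !rmorphM (rmorphXn _ n) rmorph_nat /=.
  set I := i ^+ p in ip H1 H2.
  set T1 := (2%:R * i) ^+ n in q H1 H2; set T2 := (2%:R * - i) ^+ n in q H1 H2.
  set F := 4%:R ^+ n in H1 H2 *.
  transitivity (6%:R * (2%:R * F) * (2%:R * s%:~R * B%:~R) - 24%:R * (g%:~R * N%:~R +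
    F * x%:~R * g%:~R - F * s%:~R * N%:~R)).
    by ring.
  rewrite -sE.
  have -> : s%:~R = - (i * I) by rewrite ip opprK.
  transitivity (6%:R * (2%:R * F) * (1 - i) * A2 + 6%:R * (2%:R * F) * (1 + i) * A1 
     - 12%:R * (N%:~R + F * x%:~R) * (2%:R * g%:~R) - 24%:R * (F * (i * I) * N%:~R)).
    by ring.
  rewrite H2 H1 -q; ring.
have Z1 : ((p ^ 2)%N %| 4%:R ^+ n * s * B - g * N - 4%:R ^+ n * x * g +
  4%:R ^+ n * s * N)%Z.
  by apply: (Gauss_dvdz_natr 24) Z0; rewrite coprimeXl.
(* The product of two multiples of p that controls the error. *)
have Z2 : ((p ^ 2)%N %| (g * s - 1) * (N - g * s * x))%Z.
  have -> : ((p ^ 2)%N : int) = p%:Z * p%:Z by rewrite -mulnn PoszM.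
  have G1 : (p %| g * s - 1)%Z.
    have -> : g * s - 1 = (g - s) * s by rewrite mulrBl -expr2 s2.
    exact: dvdz_mulr.
  apply: dvdz_mul => //.
  have -> : N - g * s * x = (N - x) - (g * s - 1) * x by ring.
  by apply: rpredB => //; apply: dvdz_mulr.
have Z3 : ((p ^ 2)%N %| (4 ^ n)%:R * ((4 ^ n)%:R * (B - x)))%Z.
  have -> : (4 ^ n)%:R * ((4 ^ n)%:R * (B - x)) = 
    (4%:R ^+ n * s * B - g * N - 4%:R ^+ n * x * g + 4%:R ^+ n * s * N) * (s * 4%:R ^+ n)
     - 4%:R ^+ n * (g * s) * ((g * s - 1) * (N - g * s * x)).
    rewrite natrX -g2.
    transitivity (g ^+ 2 * (g ^+ 2 * (B - x) * s ^+ 2 + g ^+ 3 * x * s * (s ^+ 2 - 1))).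
      by rewrite s2; ring.
    by ring.
  by apply: rpredB; [apply: dvdz_mulr | apply: dvdz_mull].
have cF : coprime (p ^ 2) (4 ^ n) by rewrite coprimeXl ?coprimeXr.
by apply: (Gauss_dvdz_natr _ _ _ cF); apply: (Gauss_dvdz_natr _ _ _ cF).
Qed.

(** * Trinomial coefficients against Chebyshev polynomials *)

(** Expand the power of x^2 + 4x + 1 = 2x + (1+x)^2. In other words the linear form
    u^n |-> T_n(4,1) sends (u-2)^j to C(2j,j). *)
Lemma trinomial_coef_4_1 (R : comNzRingType) n :
  trinomial_coef n (4%:R : R) 1 =
  \sum_(0 <= j < n.+1) 'C(n, j)%:R * 'C(2 * j, j)%:R * 2%:R ^+ (n - j).
Proof.
rewrite /trinomial_coef.
have -> : 'X^2 + 4%:R *: 'X + 1%:P = 2%:R *: 'X + (1 + 'X) ^+ 2 :> {poly R}.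
  by rewrite !scaler_nat polyC1; ring.
rewrite exprDn coef_sum big_mkord; apply: eq_bigr => -[j /= jn] _.
rewrite exprZn -exprM -scalerAl coefMn coefZ ['X^_ * _]mulrC coefMXn.
rewrite ltnNge leq_subr /= coef_exp_1X subKn // -mulr_natl; ring.
Qed.

(** The second difference of C(-,b+2) is C(-,b); it is the three-term recurrence of
    the Chebyshev polynomials in terms of coefficients. *)
Lemma bin_central_diff a b :
  ('C(a.+2, b.+2) + 'C(a, b.+2) = 2 * 'C(a.+1, b.+2) + 'C(a, b))%N.
Proof. rewrite !binS; lia. Qed.

(** With u = 2 sin t, the value at u^2 is cos((2i+1)t)/cos t. *)
Definition cheb_in_square (i : nat) : {poly int} :=
  \poly_(k < i.+1) ((-1) ^+ k * 'C(i + k, 2 * k)%:R).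

(** The Chebyshev polynomial of the second kind U_m(u/2), expanded at u = 2. *)
Definition cheb_at_2 (m : nat) : {poly int} :=
  \poly_(j < m.+1) 'C(m.+1 + j, (2 * j).+1)%:R.

Lemma coef_cheb_in_square i k : (cheb_in_square i)`_k = (-1) ^+ k * 'C(i + k, 2 * k)%:R.
Proof. by rewrite coef_poly; case: ltnP => // ik; rewrite bin_small ?mulr0 //; lia. Qed.

Lemma coef_cheb_at_2 m j : (cheb_at_2 m)`_j = 'C(m.+1 + j, (2 * j).+1)%:R.
Proof. by rewrite coef_poly; case: ltnP => // ik; rewrite bin_small //; lia. Qed.

Lemma cheb_in_square_rec i :
  cheb_in_square i.+2 = (2%:R - 'X) * cheb_in_square i.+1 - cheb_in_square i.
Proof.
apply/polyP => k; rewrite mulrBl mulr_natl !coefB coefMn coefXM !coef_cheb_in_square.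
case: k => [|k] /=; first by rewrite !muln0 !bin0; ring.
have := bin_central_diff (i + k).+1 (2 * k).
have -> : (2 * k.+1 = (2 * k).+2)%N by lia.
rewrite !addSn !addnS => /(congr1 (fun n => n%:R : int)).
rewrite natrD [(_ + 'C(_, 2 * k))%:R]natrD natrM => e.
rewrite (_ : 'C((i + k).+3, _)%:R = 2%:R * 'C((i + k).+2, (2 * k).+2)%:R +
  'C((i + k).+1, 2 * k)%:R - 'C((i + k).+1, (2 * k).+2)%:R :> int).
  rewrite exprS; ring.
by rewrite -e addrK.
Qed.

Lemma cheb_at_2_rec m : cheb_at_2 m.+2 = ('X + 2%:R) * cheb_at_2 m.+1 - cheb_at_2 m.
Proof.
apply/polyP => k; rewrite mulrDl mulr_natl !coefB coefD coefMn coefXM !coef_cheb_at_2.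
case: k => [|k] /=; first by rewrite !muln0 !bin1 !addn0 !mulrSr; ring.
have := bin_central_diff (m + k).+2 (2 * k).+1.
have -> : (2 * k.+1 = (2 * k).+2)%N by lia.
rewrite !addSn !addnS => /(congr1 (fun n => n%:R : int)).
rewrite natrD [(_ + 'C(_, (2 * k).+1))%:R]natrD natrM => e.
rewrite (_ : 'C((m + k).+4, _)%:R = 2%:R * 'C((m + k).+3, (2 * k).+3)%:R +
  'C((m + k).+2, (2 * k).+1)%:R - 'C((m + k).+2, (2 * k).+3)%:R :> int).
  by ring.
by rewrite -e addrK.
Qed.

(** With u = X + 2, both sides obey the three-term recurrence with multiplier
    2 - u^2; on the right it comes from iterating the recurrence of the U_m. *)
Lemma cheb_in_square_comp i :
  cheb_in_square i \Po ('X + 2%:R) ^+ 2 = (-1) ^+ i *: cheb_at_2 (2 * i).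
Proof.
have U4 m : cheb_at_2 m.+4 = (('X + 2%:R) ^+ 2 - 2%:R) * cheb_at_2 m.+2 - cheb_at_2 m.
  by have := cheb_at_2_rec m.+2; have := cheb_at_2_rec m.+1;
    have := cheb_at_2_rec m => -> -> ->; ring.
have U0 : cheb_at_2 0 = 1.
  by apply/polyP => k; rewrite coef_cheb_at_2 coef1; case: k => // k; rewrite bin_small //;
    lia.
have U1 : cheb_at_2 1 = 'X + 2%:R.
  apply/polyP => k; rewrite coef_cheb_at_2 coefD coefX -polyC_natr coefC.
  by case: k => [|[|k]] //; rewrite bin_small //; lia.
have Q0 : cheb_in_square 0 = 1.
  by apply/polyP => k; rewrite coef_cheb_in_square coef1; case: k => // k;
    rewrite bin_small ?mulr0 //; lia.
have Q1 : cheb_in_square 1 = 1 - 'X.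
  apply/polyP => k; rewrite coef_cheb_in_square coefB coefX coef1.
  by case: k => [|[|k]] //; rewrite bin_small ?mulr0 //; lia.
suff : cheb_in_square i \Po ('X + 2%:R) ^+ 2 = (-1) ^+ i *: cheb_at_2 (2 * i) /\
  cheb_in_square i.+1 \Po ('X + 2%:R) ^+ 2 = (-1) ^+ i.+1 *: cheb_at_2 (2 * i.+1) by case.
elim: i => [|i [IH0 IH1]].
  rewrite Q0 Q1 muln0 muln1 expr0 expr1 scale1r U0 comp_polyB !comp_polyC comp_polyX.
  split=> //; rewrite (cheb_at_2_rec 0) U0 U1 scaleN1r; ring.
split=> //; rewrite cheb_in_square_rec comp_polyB comp_polyM comp_polyB comp_polyX IH0
  IH1.
have -> : (2 * i.+2 = (2 * i).+4)%N by lia.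
have -> : (2 * i.+1 = (2 * i).+2)%N by lia.
rewrite U4 -polyC_natr comp_polyC -!mul_polyC !exprS !polyCM polyCN polyC1; ring.
Qed.

Lemma cheb_bin_sum i j :
  \sum_(0 <= k < i.+1) (-1) ^+ k * 'C(i + k, 2 * k)%:R *
     ('C(2 * k, j)%:R * 2%:R ^+ (2 * k - j)) =
  (-1) ^+ i * 'C((2 * i).+1 + j, (2 * j).+1)%:R :> rat.
Proof.
have := congr1 (fun q : {poly int} => (q`_j)%:~R : rat) (cheb_in_square_comp i).
rewrite coefZ coef_cheb_at_2 rmorphM (rmorphXn _ i) rmorphN1 rmorph_nat => <-.
rewrite /cheb_in_square poly_def raddf_sum /= coef_sum rmorph_sum big_mkord.
apply: eq_bigr => -[k /= ki] _.
rewrite comp_polyZ comp_Xn_poly -exprM coefZ rmorphM (rmorphM _ (_ ^+ k)) (rmorphXn _ k).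
rewrite rmorphN1 rmorph_nat; congr (_ * _).
have -> : ('X + 2%:R) ^+ (2 * k)
  = \sum_(l < (2 * k).+1) ('C(2 * k, l)%:R * 2%:R ^+ (2 * k - l)) *: 'X^l :> {poly int}.
  rewrite addrC exprDn; apply: eq_bigr => -[l /= _] _.
  by rewrite -mul_polyC polyCM polyC_exp !polyC_natr -mulr_natl; ring.
rewrite -(poly_def _ (fun l => 'C(2 * k, l)%:R * 2%:R ^+ (2 * k - l))) coef_poly.
by case: ltnP => [_|kj]; [rewrite rmorphM (rmorphXn _ (2 * k -
  j)) !rmorph_nat | rewrite bin_small // mul0r].
Qed.

Local Notation T n := (trinomial_coef n (4%:R : rat) 1).

Lemma trinomial_cheb_sum i N : (2 * i < N)%N ->
  \sum_(0 <= k < i.+1) (-1) ^+ k * 'C(i + k, 2 * k)%:R * T (2 * k) =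
  (-1) ^+ i * \sum_(0 <= j < N) ('C((2 * i).+1 + j, (2 * j).+1) * 'C(2 * j, j))%:R.
Proof.
move=> iN; rewrite mulr_sumr.
under [RHS]eq_bigr do rewrite natrM mulrA -cheb_bin_sum mulr_suml.
rewrite exchange_big /=; apply: eq_big_nat => k /andP[_ ki].
rewrite trinomial_coef_4_1 (@big_cat_nat _ _ _ (2 * k).+1 0%N N) //=; last by lia.
rewrite [X in _ = _ + X]big1_seq ?addr0; last first.
  move=> j; rewrite mem_index_iota => /andP[_ /andP[kj _]].
  by rewrite ['C(2 * k, j)]bin_small // mul0r mulr0 mul0r.
by rewrite mulr_sumr; apply: eq_bigr => j _; ring.
Qed.

(** Because of the signs (-1)^i, adding two consecutive values amounts to
    subtracting U_(2i) from U_(2i+2); by Pascal's rule the coefficients of the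
    difference at u = 2 are those of two Delannoy numbers. *)
Lemma trinomial_cheb_sum_step i :
  \sum_(0 <= k < i.+2) (-1) ^+ k * 'C(i.+1 + k, 2 * k)%:R * T (2 * k) +
  \sum_(0 <= k < i.+1) (-1) ^+ k * 'C(i + k, 2 * k)%:R * T (2 * k) =
  (-1) ^+ i.+1 * ((delannoy (2 * i.+1))%:R + (delannoy (2 * i.+1).-1)%:R).
Proof.
set N := (2 * i.+1).+1.
rewrite (trinomial_cheb_sum i.+1 N) ?(trinomial_cheb_sum i N); try by rewrite /N; lia.
rewrite (delannoy_widen (2 * i.+1) N) // (delannoy_widen _.-1 N); last by rewrite /N; lia.
have -> (x y : rat) : (-1) ^+ i.+1 * x + (-1) ^+ i * y = (-1) ^+ i.+1 * (x - y).
  by rewrite exprS; ring.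
have -> : ((2 * i.+1).-1 = (2 * i).+1)%N by lia.
congr (_ * _); apply/eqP; rewrite subr_eq -!natr_sum -!natrD; apply/eqP; congr _%:R.
rewrite -!big_split /=; apply: eq_bigr => j _; rewrite /delannoy_term.
have -> : (2 * i.+1 = (2 * i).+2)%N by lia.
rewrite -!mulnDl; congr (_ * _)%N.
by rewrite !addSn !binS; lia.
Qed.

(** The increment in n works term by term, because
    (n+2) C(n+1+k,2k) - n C(n+k,2k) = (k+1) (C(n+1+k,2k) + C(n+k,2k)): the factor k+1
    of the denominator cancels. *)
Lemma catalan_cheb_sum n :
  n%:R * n.+1%:R * \sum_(0 <= k < n.+1) (-1) ^+ k * 'C(n +
    k, 2 * k)%:R / k.+1%:R * T (2 * k) =
  \sum_(1 <= i < n.+1) (-1) ^+ i * i%:R *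
            ((delannoy (2 * i))%:R + (delannoy (2 * i).-1)%:R).
Proof.
elim: n => [|n IH]; first by rewrite !mul0r big_geq.
rewrite [RHS]big_nat_recr //= -IH.
have -> : (-1) ^+ n.+1 * n.+1%:R *
    ((delannoy (2 * n.+1))%:R + (delannoy (2 * n.+1).-1)%:R) =
  n.+1%:R * (\sum_(0 <= k < n.+2) (-1) ^+ k * 'C(n.+1 + k, 2 * k)%:R * T (2 * k) +
   \sum_(0 <= k < n.+1) (-1) ^+ k * 'C(n + k, 2 * k)%:R * T (2 * k)).
  by rewrite trinomial_cheb_sum_step; ring.
(* Sum the first two sums up to n+1 as well; the added terms vanish. *)
have E (F : nat -> rat) : (forall k, (k == n.+1)%N -> F k = 0) ->
   \sum_(0 <= k < n.+1) F k = \sum_(0 <= k < n.+2) F k.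
  by move=> F0; rewrite [RHS]big_nat_recr //= F0 ?addr0.
have C0 k : (k == n.+1)%N -> 'C(n + k, 2 * k) = 0%N
  by move=> /eqP ->; apply: bin_small; lia.
rewrite !E; try by move=> k /C0 ->; rewrite ?mulr0 ?mul0r.
rewrite -big_split /= !mulr_sumr -big_split /=; apply: eq_big_nat => k /andP[_ kn].
have k1 : k.+1%:R != 0 :> rat by rewrite pnatr_eq0.
have e : (n.+1%:R + k%:R) * 'C(n + k, 2 * k)%:R
  = (n.+1%:R - k%:R) * 'C(n.+1 + k, 2 * k)%:R :> rat.
  rewrite -natrB // -natrD -!natrM; congr _%:R.
  have := mul_bin_down (n.+1 + k) (2 * k); rewrite addSn /= => ->; congr (_ * _)%N; lia.
apply: (mulIf k1); move: e.
rewrite [(n.+2)%:R]mulrSr [(n.+1)%:R]mulrSr [(k.+1)%:R in X in _ -> X]mulrSr => e.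
rewrite [(k.+1)%:R]mulrSr in k1.
move: (T _) => t; move: e; move: ('C(n + k, _)%:R) ('C(n.+1 + k, _)%:R) => c0 c1 e.
apply/eqP; rewrite -subr_eq0.
set d := (X in X == 0).
have -> : d = - (n%:R + 1) * (-1) ^+ k * t *
    ((n%:R + 1 + k%:R) * c0 - (n%:R + 1 - k%:R) * c1) by rewrite /d; field.
by rewrite e subrr mulr0.
Qed.

(** * Central binomial coefficients modulo the square of a prime *)

(** 4^k (n+k)(n+k-1)...(n-k+1) is the product of the p^2 - (2j-1)^2 for 1 <= j <= k,
    which modulo p^2 is the square of an odd double factorial up to sign. *)
Lemma fact_halfprime_cong p n k : p = (2 * n).+1 -> (k <= n)%N ->
  ((p ^ 2)%N %| ((2 * k)`!%:R ^+ 2 : int)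
     - (- 16%:R) ^+ k * ((n + k) ^_ (2 * k))%:R * k`!%:R ^+ 2)%Z.
Proof.
move=> pE; elim: k => [|k IH] kn; first by rewrite muln0 addn0 ffactn0 !fact0 subrr dvdz0.
have {IH} := IH (ltnW kn).
have -> : (2 * k.+1 = (2 * k).+2)%N by lia.
rewrite addnS ffactSS ffactnSr !factS !natrM.
have -> : (n + k - 2 * k = n - k)%N by lia.
rewrite natrB ?(ltnW kn) // [(- 16%:R) ^+ k.+1]exprS.
set F := (2 * k)`!%:R; set f := k`!%:R; set X := ((n + k) ^_ (2 * k))%:R; set c := _ ^+ k.
move=> /dvdzP[q qE].
have -> : ((p ^ 2)%N : int) = (2%:R * n%:R + 1) ^+ 2.
  by rewrite pE -natz natrX mulrSr natrM.
have {}qE : F ^+ 2 = c * X * f ^+ 2 + q * (2%:R * n%:R + 1) ^+ 2.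
  move: qE; have -> : ((p ^ 2)%N : int) = (2%:R * n%:R + 1) ^+ 2.
    by rewrite pE -natz natrX mulrSr natrM.
  by move=> <-; ring.
have e2 : ((2 * k).+2)%:R = 2%:R * (k%:R + 1) :> int by rewrite !mulrSr natrM; ring.
have e1 : ((2 * k).+1)%:R = 2%:R * k%:R + 1 :> int by rewrite !mulrSr natrM; ring.
have e3 : ((n + k).+1)%:R = n%:R + k%:R + 1 :> int by rewrite mulrSr natrD.
have e4 : (k.+1)%:R = k%:R + 1 :> int by rewrite mulrSr.
(* 4(n+k+1)(n-k) = p^2 - (2k+1)^2; the witness collects the multiples of p^2. *)
apply/dvdzP; exists (4%:R * (k%:R + 1) ^+ 2 * (2%:R * k%:R + 1) ^+ 2 * q
   + 4%:R * (k%:R + 1) ^+ 2 * (c * X * f ^+ 2)).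
rewrite e1 e2 e3 e4.
rewrite [LHS](_ : _ = (2%:R * (k%:R + 1) * (2%:R * k%:R + 1)) ^+ 2 * F ^+ 2 -
  - 16%:R * c * ((n%:R + k%:R + 1) * (X * (n%:R - k%:R))) * ((k%:R + 1) * f) ^+ 2);
    last by ring.
rewrite qE; ring.
Qed.

Lemma central_bin_cong p n k : prime p -> p = (2 * n).+1 -> (k <= n)%N ->
  ((p ^ 2)%N %| ('C(2 * k, k)%:R : int) - (- 16%:R) ^+ k * 'C(n + k, 2 * k)%:R)%Z.
Proof.
move=> pp pE kn.
have cf j : (j < p)%N -> coprime p j`!.
  elim: j => [|j IH] jp; first by rewrite fact0 coprimen1.
  by rewrite factS coprimeMr IH ?(ltnW jp) // andbT prime_coprime // gtnNdvd.
apply: (Gauss_dvdz_natr ((2 * k)`! * k`! ^ 2)).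
  by rewrite coprimeXl // coprimeMr coprimeXr ?cf //; lia.
have kk : (k <= 2 * k)%N by lia.
have := bin_fact kk; have -> : (2 * k - k = k)%N by lia.
have := fact_halfprime_cong p n k pE kn.
rewrite -bin_ffact; move: ('C(2 * k, k)) ('C(n + k, 2 * k)) => b c.
move: ((2 * k)`!) k`! => F f H E.
suff -> : (F * f ^ 2)%:R * (b%:R - (- 16%:R) ^+ k * c%:R) =
   F%:R ^+ 2 - (- 16%:R) ^+ k * (c * F)%N%:R * f%:R ^+ 2 :> int by [].
move: ((- 16%:R) ^+ k : int) => z.
have E' : F%:R = b%:R * (f%:R * f%:R) :> int by rewrite -E !natrM.
rewrite natrM natrX [(c * F)%N%:R]natrM [F%:R ^+ 2]expr2 {3}E'; ring.
Qed.

(** * The Euler criterion *)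

Lemma intr_Fp_eq0 p (z : int) : prime p -> (z%:~R == 0 :> 'F_p) = (p %| z)%Z.
Proof.
move=> pp; have pc := pchar_Fp pp.
have -> : (z%:~R == 0 :> 'F_p) = (`|z|%N%:R == 0 :> 'F_p).
  by case: z => m //=; rewrite NegzE rmorphN oppr_eq0.
by rewrite -(dvdn_pcharf pc) dvdzE.
Qed.

Lemma exp_half_nonsquare p n (a : 'F_p) : prime p -> p = (2 * n).+1 ->
  a ^+ n = 1 -> exists2 x : nat, (x < p)%N & x%:R ^+ 2 = a.
Proof.
move=> pp pE an1; have n0 : (0 < n)%N by move: (prime_gt1 pp); lia.
have ferm (x : 'F_p) : x != 0 -> x ^+ (2 * n) = 1.
  move=> x0; apply: (mulfI x0); rewrite mulr1 -exprS -pE.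
  by have := expf_card x; rewrite card_Fp.
have n_eq0 (m : nat) : (0 < m < p)%N -> m%:R != 0 :> 'F_p.
  by case/andP=> m0 mp; rewrite -(dvdn_pcharf (pchar_Fp pp)) gtnNdvd.
pose f (i : nat) : 'F_p := i%:R ^+ 2.
have [/mapP[x] | aN] := boolP (a \in [seq f i | i <- iota 1 n]).
  by rewrite mem_iota => xn ->; exists x => //; lia.
(* Otherwise a and the n squares would be n+1 roots of X^n - 1. *)
have uq : uniq (a :: [seq f i | i <- iota 1 n]).
  rewrite /= aN map_inj_in_uniq ?iota_uniq // => i j; rewrite !mem_iota => hi hj.
  wlog ij : i j hi hj / (i <= j)%N => [H|].
    by case/orP: (leq_total i j) => le e; [apply: H | apply/esym/H].
  move=> /eqP; rewrite eq_sym -subr_eq0 subr_sqr mulf_eq0 -natrB // -natrD => /orP[] e0.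
    apply/eqP; rewrite eqn_leq ij /= -subn_eq0; apply: contraLR e0 => ne; apply: n_eq0;
      lia.
  by case/negP: (n_eq0 (j + i)%N ltac:(lia)).
have nz : 'X^n - 1 != 0 :> {poly 'F_p} by rewrite -size_poly_eq0 size_XnsubC.
have /(max_poly_roots nz)/(_ uq) : all (root ('X^n - 1)) (a :: [seq f i | i <- iota 1 n]).
  apply/allP => y; rewrite inE => /orP[/eqP ->|/mapP[i]].
    by rewrite rootE !hornerE an1 subrr.
  rewrite mem_iota => hi ->; rewrite rootE !hornerE /f -exprM ferm ?subrr //.
  by apply: n_eq0; lia.
by rewrite size_XnsubC // /= size_map size_iota ltnn.
Qed.

Lemma legendre_euler p n (a : int) : prime p -> p = (2 * n).+1 ->
  (p %| legendre a p - a ^+ n)%Z.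
Proof.
move=> pp pE; have n0 : (0 < n)%N by move: (prime_gt1 pp); lia.
rewrite -intr_Fp_eq0 // rmorphB rmorphXn /= subr_eq0 /legendre.
have ferm (x : 'F_p) : x != 0 -> x ^+ (2 * n) = 1.
  move=> x0; apply: (mulfI x0); rewrite mulr1 -exprS -pE.
  by have := expf_card x; rewrite card_Fp.
rewrite -intr_Fp_eq0 //; have [a0|a0] := eqVneq (a%:~R : 'F_p) 0.
  by rewrite a0 expr0n (gtn_eqF n0).
case: ifP => [/existsP[x]|/negbT/existsPn nx].
  rewrite eqz_mod_dvd -intr_Fp_eq0 // rmorphB rmorphXn subr_eq0 /= => /eqP xa.
  rewrite -xa -exprM ferm //; apply: contraNneq a0 => x0.
  by rewrite -xa x0 expr0n.
have /eqP : (a%:~R ^+ n - 1) * (a%:~R ^+ n + 1) = 0 :> 'F_p.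
  by rewrite -subr_sqr -exprM mulnC ferm // expr1n subrr.
rewrite mulf_eq0 subr_eq0 addr_eq0 => /orP[/eqP an1|/eqP ->]; last by rewrite rmorphN1.
have [x xp xa] := exp_half_nonsquare p n _ pp pE an1.
have /negP[] := nx (Ordinal xp).
by rewrite eqz_mod_dvd -intr_Fp_eq0 // rmorphB rmorphXn subr_eq0 /= xa.
Qed.

(** * Rationals integral at p *)

Lemma p_integralP p (x : rat) :
  reflect (exists (d : nat) (m : int), coprime p d /\ x * d%:R = m%:~R)
          (x \in p_integral p).
Proof.
rewrite inE; apply: (iffP idP) => [cp|[d [m [cd e]]]].
  exists `|denq x|%N, (numq x); split=> //.
  by rewrite pmulrn absz_denq -numqE.
apply: coprime_dvdr cd.
have e' : (numq x * d%:Z = m * denq x).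
  apply: (@intr_inj rat); rewrite !rmorphM /= -e numqE; ring.
have : (denq x %| d%:Z)%Z.
  have cz : coprimez (denq x) (numq x) by rewrite coprimez_sym; exact: coprime_num_den.
  by rewrite -(Gauss_dvdzr _ cz) e' dvdz_mull.
by rewrite dvdzE.
Qed.

Section PIntegral.
Variable p : nat.
Local Notation I := (p_integral p).

Lemma p_integral_intr (m : int) : m%:~R \in I.
Proof. by apply/p_integralP; exists 1%N, m; rewrite coprimen1 mulr1. Qed.

Lemma p_integral_natr (m : nat) : m%:R \in I.
Proof. exact: p_integral_intr m. Qed.

Lemma p_integralD x y : x \in I -> y \in I -> x + y \in I.
Proof.
move=> /p_integralP[d [m [cd e]]] /p_integralP[d' [m' [cd' e']]].
apply/p_integralP; exists (d * d')%N, (m * d'%:Z + m' * d%:Z).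
rewrite coprimeMr cd cd'; split=> //.
rewrite natrM rmorphD !rmorphM /= -e -e' !pmulrn; ring.
Qed.

Lemma p_integralM x y : x \in I -> y \in I -> x * y \in I.
Proof.
move=> /p_integralP[d [m [cd e]]] /p_integralP[d' [m' [cd' e']]].
apply/p_integralP; exists (d * d')%N, (m * m').
rewrite coprimeMr cd cd'; split=> //.
rewrite natrM rmorphM /= -e -e'; ring.
Qed.

Lemma p_integralN x : x \in I -> - x \in I.
Proof. by move=> xI; rewrite -mulN1r p_integralM // (p_integral_intr (-1)). Qed.

Lemma p_integralV (d : nat) : (0 < d)%N -> coprime p d -> d%:R^-1 \in I.
Proof.
move=> d0 cd; apply/p_integralP; exists d, 1; split=> //.
by rewrite mulVf // pnatr_eq0 -lt0n.
Qed.

Lemma p_integral_sum m n (F : nat -> rat) :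
  (forall k, (m <= k < n)%N -> F k \in I) -> \sum_(m <= k < n) F k \in I.
Proof.
move=> FI; rewrite big_seq; apply: (big_ind (fun x => x \in I)) => [||k].
- exact: (p_integral_natr 0).
- exact: p_integralD.
by rewrite mem_index_iota; apply: FI.
Qed.

End PIntegral.

Lemma p_congr_of_quotient p m x y z :
  y \in p_integral p -> z \in p_integral p -> x = y + m%:R * z -> p_congr p m x y.
Proof.
move=> yI zI xE; split=> //; last by exists z; rewrite // xE addrC addKr.
by rewrite xE p_integralD // p_integralM // p_integral_natr.
Qed.

(** * The supercongruence *)

Lemma abs_legendre_le1 a p : (`|legendre a p| <= 1)%N.
Proof. by rewrite /legendre; case: ifP => // _; case: ifP. Qed.

Lemma eq_small_mod (p : nat) (a b : int) : (2 < p)%N ->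
  (`|a| <= 1)%N -> (`|b| <= 1)%N -> (p %| a - b)%Z -> a = b.
Proof.
move=> p2 a1 b1 pab; apply/eqP; rewrite -subr_eq0 -absz_eq0.
have : (`|a - b| < p)%N by lia.
by apply: contraTT => n0; rewrite -leqNgt dvdn_leq // lt0n.
Qed.

Theorem theorem1p2 (p : nat) (p_prime : prime p) (p_gt3 : (3 < p)%N) :
  p_congr p (p ^ 2)
    (\sum_(0 <= k < (p.-1)./2.+1)
       'C(2 * k, k)%:R / (k.+1%:R * 16%:R ^+ k)
         * trinomial_coef (2 * k) (4%:R : rat) 1)
    (4%:R / 3%:R * ((legendre 3 p)%:~R - p%:R * (legendre (-1) p)%:~R)).
Proof.
set n := (p.-1)./2.
have pE : p = (2 * n).+1.
  have := odd_prime_gt2; rewrite /n; case: (even_prime p_prime) => [|op _]; first by lia.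
  by have := odd_double_half p.-1; lia.
have co d : (0 < d < p)%N -> coprime p d.
  by move=> dp; rewrite prime_coprime // gtnNdvd //; case/andP: dp.
have [Bdvd chidvd] := delannoy_sum_mod p n p_prime p_gt3 pE.
have small_sign m : (`|((-1) ^+ m : int)| <= 1)%N by rewrite abszX exp1n.
have leg_small a : (`|legendre a p| <= 1)%N by exact: abs_legendre_le1.
(* Both Legendre symbols are determined by their residues, as p > 2. *)
have L3 : legendre 3 p = twelfth_sign p.
  apply: (eq_small_mod p); rewrite ?leg_small ?small_sign //; first by lia.
  rewrite -[_ - _](subrKA (3 ^+ n)) rpredD ?legendre_euler //.
  by rewrite -opprB rpredN.
have Lm1 : legendre (-1) p = (-1) ^+ n.
  by apply: (eq_small_mod p); rewrite ?leg_small ?small_sign ?legendre_euler //; lia.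
rewrite L3 Lm1.
pose T k := trinomial_coef (2 * k) (4%:R : rat) 1.
have TI k : T k \in p_integral p.
  rewrite /T trinomial_coef_4_1; apply: p_integral_sum => j _.
  by rewrite -natrX -!natrM p_integral_natr.
(* e k is the quotient by p^2 in the congruence for C(2k,k). *)
have /all_sig[e eE] : forall k, {e : int | (k <= n)%N ->
    'C(2 * k, k)%:R = (- 16%:R) ^+ k * 'C(n + k, 2 * k)%:R + e * (p%:Z ^+ 2)}.
  move=> k; case: (leqP k n) => kn; last by exists 0.
  have /dvdzP/sig_eqW[e eE] := central_bin_cong p n k p_prime pE kn.
  by exists e => _; rewrite -[LHS](subrK ((-16%:R) ^+ k * 'C(n +
    k, 2 * k)%:R)) eE addrC -natz natrX natz.
pose G := \sum_(0 <= k < n.+1) (-1) ^+ k * 'C(n + k, 2 * k)%:R / k.+1%:R * T k.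
pose E := \sum_(0 <= k < n.+1) (e k)%:~R / (k.+1%:R * 16%:R ^+ k) * T k.
have SE : \sum_(0 <= k < n.+1) 'C(2 * k, k)%:R / (k.+1%:R * 16%:R ^+ k) * T k =
    G + p%:R ^+ 2 * E.
  rewrite mulr_sumr -big_split /=; apply: eq_big_nat => k /andP[_ kn].
  have -> : 'C(2 * k, k)%:R =
    (- 16%:R) ^+ k * 'C(n + k, 2 * k)%:R + (e k)%:~R * p%:R ^+ 2 :> rat.
    have /(congr1 (fun z : int => z%:~R : rat)) := eE k kn.
    by rewrite rmorphD (rmorphM _ (_ ^+ k)) (rmorphM _ (e k)) !(rmorphXn _ k)
      (rmorphXn _ 2) rmorphN !rmorph_nat.
  have k1 : k.+1%:R != 0 :> rat by rewrite pnatr_eq0.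
  have k16 : 16%:R ^+ k != 0 :> rat by rewrite expf_neq0 // pnatr_eq0.
  rewrite [(- 16%:R) ^+ k]exprNn; move: k16 k1; move: (16%:R ^+ k) (k.+1%:R) => x y x0 y0.
  by field; rewrite x0 y0.
have I3 : (3%:R : rat)^-1 \in p_integral p by apply: p_integralV => //; apply: co; lia.
have signI k : (-1) ^+ k \in p_integral p.
  by rewrite -[(-1) ^+ k](rmorphXn (intr : int -> rat) k (-1)) p_integral_intr.
have coC k : (k < n.+1)%N -> (k.+1%:R : rat)^-1 \in p_integral p.
  by move=> kn; apply: p_integralV => //; apply: co; lia.
have EI : E \in p_integral p.
  apply: p_integral_sum => k /andP[_ kn]; rewrite !p_integralM ?p_integral_intr ?TI //.
  rewrite invfM p_integralM ?coC // -natrX p_integralV ?expn_gt0 //.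
  rewrite coprimeXr // (_ : 16 = 2 ^ 4)%N // coprimeXr // co //; lia.
have GI : G \in p_integral p.
  apply: p_integral_sum => k /andP[_ kn];
    by rewrite !p_integralM ?TI ?coC ?p_integral_natr ?signI.
have := catalan_cheb_sum n; have := alternating_delannoy_sum n.
rewrite -/G; set A := \sum_(1 <= i < n.+1) _ => BA GA.
have {Bdvd} [b bE] : exists b : int, delannoy_sum n = twelfth_sign p + b * p%:Z ^+ 2.
  have /dvdzP[b bE] := Bdvd; exists b.
  by rewrite -[LHS](subrK (twelfth_sign p)) bE addrC -natz natrX natz.
have [c cE] : exists c : int,
    (delannoy (2 * n))%:R + (delannoy (2 * n).+1)%:R = 4%:R + c * p%:R :> int.
  have e1 : p.-1 = (2 * n)%N by rewrite {1}pE.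
  have := congr2 addn (delannoy_prime_pred p p_prime) (delannoy_prime p p_prime).
  rewrite e1 -pE => /(congr1 (fun m => m %% p)%N); rewrite !modnDm => h4.
  set D := (delannoy (2 * n) + delannoy p)%N in h4.
  exists ((D %/ p)%N%:R - (4 %/ p)%N%:R); rewrite -natrD -/D.
  have -> : 4%:R = (4 %/ p * p + D %% p)%N%:R :> int by rewrite h4 -divn_eq.
  by rewrite [in LHS](divn_eq D p) !natrD !natrM; ring.
have p0 : p%:R = 2%:R * n%:R + 1 :> rat by rewrite pE mulrSr natrM.
(* G = p^2 G - 4n(n+1) G = p^2 G - 4A, and 12A = (-1)^n p (4 + c p) - 4B. *)
rewrite SE; apply: (p_congr_of_quotient p _ _ _
  (E + G + (4%:R * b%:~R - (-1) ^+ n * c%:~R) / 3%:R)).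
- apply: p_integralM; first by rewrite p_integralM ?p_integral_natr.
  apply: p_integralD; first exact: p_integral_intr.
  by apply: p_integralN; rewrite p_integralM ?p_integral_natr ?p_integral_intr.
- rewrite p_integralD ?p_integralD // p_integralM // p_integralD //.
    by rewrite p_integralM ?p_integral_natr ?p_integral_intr.
  by apply: p_integralN; rewrite p_integralM ?signI ?p_integral_intr.
have {}bE : (delannoy_sum n)%:~R = (twelfth_sign p)%:~R + b%:~R * p%:R ^+ 2 :> rat.
  by rewrite bE rmorphD (rmorphM _ b) (rmorphXn _ 2).
have {}cE : (delannoy (2 * n))%:R + (delannoy (2 * n).+1)%:R = 4%:R + c%:~R * p%:R :> rat.
  by have /(congr1 (intr : int -> rat)) := cE; rewrite !rmorphD rmorphM !rmorph_nat.
have nn : (2 * n).+1%:R = p%:R :> rat by rewrite pE.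
move: BA; rewrite bE cE nn -GA (rmorphXn _ n) rmorphN1 natrX [n.+1%:R]mulrSr.
move: (twelfth_sign p)%:~R (b%:~R) (c%:~R) ((-1) ^+ n) (p%:R) (n%:R) p0
  => x y z s P m -> h.
by clear -h; move: G E h => G E h; lra.
Qed.
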